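(* Let $f:\{0,1\}^n\to\{0,1\}$ be a boolean function with expectation $\mu=\mathbb{E}f$ (with respect to the uniform measure on $\{0,1\}^n$). Then $$\sum_{i=1}^n I_i^2(f)\ \ge\ 4\mu(1-\mu)\exp\left\{-\frac{1/2}{\mu(1-\mu)}\sum_{i=1}^n I_i(f)\right\}.$$
   Context: $\{0,1\}^n$ carries the uniform probability measure. For $1\le i\le n$, $e_i$ is the vector with $1$ in coordinate $i$ and $0$ elsewhere, and $\oplus$ is coordinatewise addition mod 2. The influence of the $i$-th variable on $f$ is $I_i(f)=\Pr_x[f(x)\ne f(x\oplus e_i)]$ for $x$ uniform, i.e. the fraction of edges of the cube in direction $i$ that join the support of $f$ to its complement. *)

(* Defs.v *)
From HB Require Import structures.
From mathcomp Require Import all_boot all_order all_algebra.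
From mathcomp Require Import reals.

Set Implicit Arguments.
Unset Strict Implicit.
Unset Printing Implicit Defensive.

Import Order.TTheory GRing.Theory Num.Theory.
Local Open Scope ring_scope.

Notation cube n := {ffun 'I_n -> bool}.

Definition cube_add (n : nat) (x y : cube n) : cube n :=
  [ffun j => x j (+) y j].

Definition cube_e (n : nat) (i : 'I_n) : cube n := [ffun j => j == i].

Definition Pr (R : realType) (n : nat) (A : pred (cube n)) : R :=
  #|A|%:R / #|{: cube n}|%:R.

Definition expect (R : realType) (n : nat) (g : cube n -> R) : R :=
  (\sum_(x : cube n) g x) / #|{: cube n}|%:R.

Definition mean (R : realType) (n : nat) (f : cube n -> bool) : R :=
  expect (fun x => (f x)%:R).

Definition influence (R : realType) (n : nat) (f : cube n -> bool)
    (i : 'I_n) : R :=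
  Pr R [pred x | f x != f (cube_add x (cube_e i))].

(* Main.v *)
Require Import Defs.
From HB Require Import structures.
From mathcomp Require Import all_boot all_order all_algebra ring lra.
From mathcomp Require Import boolp reals topology normedtype derive.
From mathcomp Require Import sequences realfun exp.

Set Implicit Arguments.
Unset Strict Implicit.
Unset Printing Implicit Defensive.

Import Order.TTheory GRing.Theory Num.Theory.
Import numFieldNormedType.Exports.
Local Open Scope ring_scope.

(* Averaging [f] over one coordinate after the other gives a martingale from
   [f] to the constant [mu], whose differences [d_i] satisfy
   [sum E d_i^2 = mu (1 - mu)] and [E |d_i| <= I_i / 2], and whose energies
   [sum_j E (d_i x - d_i (x + e_j))^2] add up to that of [f], [sum I_i].  The
   logarithmic Sobolev inequality bounds half the energy of [d_i] from below by
   [Ent (d_i^2) >= E d_i^2 * ln (E d_i^2 / (E |d_i|)^2)]; summing over [i] and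
   using the convexity of [x ln x] gives the theorem. *)

(** * Inequalities for reals, chiefly the two-point logarithmic Sobolev inequality *)

Section RealInequalities.
Variable R : realType.
Implicit Types a b c d t u x y : R.

Lemma is_derive_ge0_le (f df : R -> R) a b : a <= b ->
    (forall x, a <= x <= b -> is_derive x 1 f (df x)) ->
    (forall x, a <= x <= b -> 0 <= df x) ->
  f a <= f b.
Proof.
move=> ab fdf df_ge0.
have sub x : x \in `]a, b[ -> a <= x <= b.
  by rewrite in_itv /= => /andP[/ltW -> /ltW ->].
apply: (@ger0_derive1_le_cc _ f a b) => //.
- by move=> x /sub /fdf [].
- by move=> x /sub xab; have [_] := fdf _ xab; rewrite derive1E => ->; apply: df_ge0.
- apply: derivable_within_continuous => x; rewrite in_itv /= => /fdf [] //.
- by rewrite in_itv /= lexx.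
- by rewrite in_itv /= lexx andbT.
Qed.

Lemma expR_ge_taylor2 u : 0 <= u -> 1 + u + u ^+ 2 / 2 <= expR u.
Proof.
move=> u_ge0; rewrite -subr_ge0.
pose f x := expR x - (1 + x + x ^+ 2 / 2).
have -> : 0 = f 0 by rewrite /f expR0; field.
apply: (@is_derive_ge0_le f (fun x => expR x - (1 + x))) => // x _.
  rewrite /f; apply: is_derive_eq.
  by rewrite /GRing.scale /=; field.
by rewrite subr_ge0 expR_ge1Dx.
Qed.

Lemma ln_le_subr1 x : 0 < x -> ln x <= x - 1.
Proof. by move=> x0; rewrite -{1}[x](subrKC 1); apply: le_ln1Dx; lra. Qed.

Lemma ln_sqr x : 0 < x -> ln (x ^+ 2) = 2 * ln x.
Proof. by move=> x0; rewrite lnXn // mulr_natl. Qed.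

(** Twice the two-point inequality for the values 1 and [t], its normal form under scaling. Left
    side minus right side vanishes at 1 and is nondecreasing on (0, 1]. *)
Lemma two_point_log_sobolev_unit t : 0 < t <= 1 ->
  2 * t ^+ 2 * ln t - (1 + t ^+ 2) * (ln (1 + t ^+ 2) - ln 2) <= (1 - t) ^+ 2.
Proof.
move=> /andP[t0 t1]; rewrite -subr_le0.
pose f x : R :=
  2 * x ^+ 2 * ln x - (1 + x ^+ 2) * (ln (1 + x ^+ 2) - ln 2) - (1 - x) ^+ 2.
have -> : 0 = f 1 by rewrite /f expr1n ln1 (_ : 1 + 1 = 2) //; ring.
pose df x : R := 4 * x * ln x - 2 * x * (ln (1 + x ^+ 2) - ln 2) + 2 * (1 - x).
have xgt0 x : t <= x <= 1 -> 0 < x by move=> /andP[/(lt_le_trans t0)].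
have f_df x : t <= x <= 1 -> is_derive x 1 f (df x).
  move=> /xgt0 x0; have x20 : 0 < 1 + x ^+ 2 by rewrite addr_gt0 // exprn_gt0.
  have D1 := is_derive1_ln x0.
  have D2 : is_derive x 1 (fun y : R => ln (1 + y ^+ 2)) ((2 * x) * (1 + x ^+ 2)^-1).
    have D3 := is_derive1_ln x20.
    have D4 : is_derive x 1 (fun y : R => 1 + y ^+ 2) (2 * x).
      by apply: is_derive_eq; rewrite /GRing.scale /=; ring.
    by rewrite mulrC; exact: (@is_derive1_comp _ _ (fun y : R => 1 + y ^+ 2) _ _ _ D3 D4).
  rewrite /f; apply: is_derive_eq.
  rewrite /GRing.scale /df /=; field; lra.
suff df_ge0 x : t <= x <= 1 -> 0 <= df x by exact: is_derive_ge0_le t1 f_df df_ge0.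
move=> tx1; have x0 := xgt0 x tx1; have /andP[_ x1] := tx1.
have x20 : 0 < 1 + x ^+ 2 by rewrite addr_gt0 // exprn_gt0.
have xV0 : 0 < x^-1 by rewrite invr_gt0.
have xV1 : 1 <= x^-1 by rewrite invf_ge1.
(* This is [0 <= df x] divided by [2 * x]. With [u = x^-1 - 1] the argument of [ln] is exactly
   [1 + u + u ^+ 2 / 2]. *)
have : ln ((1 + (x ^+ 2)^-1) / 2) <= x^-1 - 1.
  rewrite -ler_expR lnK ?posrE; last first.
    by rewrite divr_gt0 // addr_gt0 // invr_gt0 exprn_gt0.
  rewrite [leLHS](_ : _ = 1 + (x^-1 - 1) + (x^-1 - 1) ^+ 2 / 2).
    by rewrite expR_ge_taylor2 // subr_ge0.
  by field; rewrite gt_eqF.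
rewrite (_ : (1 + (x ^+ 2)^-1) / 2 = (1 + x ^+ 2) / (2 * x ^+ 2)); last by field; lra.
rewrite ln_div ?posrE ?mulr_gt0 ?exprn_gt0 // lnM ?posrE ?exprn_gt0 // ln_sqr // => H.
have : x * (ln (1 + x ^+ 2) - (ln 2 + 2 * ln x)) <= x * (x^-1 - 1).
  by rewrite ler_pM2l.
rewrite [X in _ <= X -> _]mulrBr mulr1 mulfV ?gt_eqF //.
by rewrite /df; lra.
Qed.

(* The degenerate cases rely on [ln 0 = 0]. *)
Lemma two_point_log_sobolev a b : 0 <= a -> 0 <= b ->
  (a ^+ 2 * ln (a ^+ 2) + b ^+ 2 * ln (b ^+ 2)) / 2
    - (a ^+ 2 + b ^+ 2) / 2 * ln ((a ^+ 2 + b ^+ 2) / 2) <= (a - b) ^+ 2 / 2.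
Proof.
wlog ba : a b / b <= a.
  move=> H a0 b0; have [|/ltW] := leP b a; first by move=> /H; exact.
  move=> /H => /(_ b0 a0); rewrite -(opprB a b) sqrrN [b ^+ 2 + _]addrC.
  by rewrite [b ^+ 2 * _ + _]addrC.
rewrite le_eqVlt => /predU1P[a0 b0|a0].
  have -> : b = 0 by apply/le_anti; rewrite b0 a0 ba.
  by rewrite -a0 expr0n /= !(mul0r, addr0, subr0) expr0n mul0r.
rewrite le_eqVlt => /predU1P[<-|b0].
  rewrite expr0n /= !(mul0r, addr0, subr0).
  rewrite ln_div ?posrE ?exprn_gt0 //.
  suff: ln 2 <= 1 :> R by have := exprn_gt0 2 a0; nra.
  by have := @ln_le_subr1 2; lra.
have t0 : 0 < b / a by rewrite divr_gt0.
(* Both sides are homogeneous of degree 2: the logarithms of the scale cancel. *)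
have := @two_point_log_sobolev_unit (b / a).
rewrite t0 ler_pdivrMr // mul1r => /(_ ba).
have -> : 1 + (b / a) ^+ 2 = (a ^+ 2 + b ^+ 2) / a ^+ 2 by field; rewrite gt_eqF.
have a20 := exprn_gt0 2 a0; have b20 := exprn_gt0 2 b0.
have ab0 : 0 < a ^+ 2 + b ^+ 2 by lra.
rewrite !ln_div ?posrE // !ln_sqr // -(ler_pM2l a20).
rewrite [X in _ <= X -> _](_ : _ = (a - b) ^+ 2); last by field; rewrite gt_eqF.
rewrite [X in X <= _ -> _](_ : _ = 2 * b ^+ 2 * (ln b - ln a) -
  (a ^+ 2 + b ^+ 2) * (ln (a ^+ 2 + b ^+ 2) - 2 * ln a - ln 2));
  last by field; rewrite gt_eqF.
lra.
Qed.

(** Reverse triangle inequality for the normalised Euclidean norm on the plane, by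
    Cauchy-Schwarz. *)
Lemma sqrt_mean_sq_dist a b c d : 0 <= a -> 0 <= b -> 0 <= c -> 0 <= d ->
  (Num.sqrt ((a ^+ 2 + b ^+ 2) / 2) - Num.sqrt ((c ^+ 2 + d ^+ 2) / 2)) ^+ 2
    <= ((a - c) ^+ 2 + (b - d) ^+ 2) / 2.
Proof.
move=> a0 b0 c0 d0.
set x := (a ^+ 2 + _) / 2; set y := (c ^+ 2 + _) / 2.
have x0 : 0 <= x by rewrite /x; nra.
have y0 : 0 <= y by rewrite /y; nra.
have H : (a * c + b * d) / 2 <= Num.sqrt x * Num.sqrt y.
  rewrite -sqrtrM // -[leLHS]ger0_norm; last by rewrite divr_ge0 // addr_ge0 // mulr_ge0.
  rewrite -sqrtr_sqr; apply: ler_wsqrtr; rewrite /x /y.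
  rewrite -subr_ge0 (_ : _ - _ = ((a * d - b * c) / 2) ^+ 2) ?sqr_ge0 //; by field.
rewrite sqrrB !sqr_sqrtr // mulr2n; rewrite /x /y in H *; lra.
Qed.

(** The right-hand side is [a * ln (a / b ^+ 2)], and the bound is [ln y <= y - 1] at
    [y = c * b ^+ 2 / a]. *)
Lemma ln_ratio_ge a b c : 0 < a -> 0 < b -> 0 < c ->
  a * (ln c + 1) - c * b ^+ 2 <= 2 * a * ln (a / b) - a * ln a.
Proof.
move=> a0 b0 c0; have b20 := exprn_gt0 2 b0.
have cb0 : 0 < c * b ^+ 2 by rewrite mulr_gt0.
have := ln_le_subr1 (divr_gt0 cb0 a0).
rewrite !ln_div ?posrE // lnM ?posrE // ln_sqr // -(ler_pM2l a0).
have -> : a * (c * b ^+ 2 / a - 1) = c * b ^+ 2 - a by field; rewrite gt_eqF.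
lra.
Qed.

End RealInequalities.

(** * Expectation as a positive linear functional *)

Section Expectation.
Variables (R : realType) (n : nat).
Implicit Types g h : cube n -> R.

Lemma card_cube_gt0 : 0 < #|{: cube n}|%:R :> R.
Proof. by rewrite ltr0n; apply/card_gt0P; exists [ffun=> false]. Qed.

Lemma expectD g h : expect (fun x => g x + h x) = expect g + expect h.
Proof. by rewrite /expect big_split /= mulrDl. Qed.

Lemma expectZ (a : R) g : expect (fun x => a * g x) = a * expect g.
Proof. by rewrite /expect -mulr_sumr mulrA. Qed.

Lemma expectB g h : expect (fun x => g x - h x) = expect g - expect h.
Proof. by rewrite /expect sumrB mulrBl. Qed.

Lemma expect_cst (a : R) : expect (fun _ : cube n => a) = a.
Proof.
by rewrite /expect sumr_const -[X in X / _]mulr_natr mulfK // gt_eqF // card_cube_gt0.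
Qed.

Lemma le_expect g h : (forall x, g x <= h x) -> expect g <= expect h.
Proof.
by move=> gh; rewrite /expect ler_pM2r ?invr_gt0 ?card_cube_gt0 // ler_sum.
Qed.

Lemma expect_ge0 g : (forall x, 0 <= g x) -> 0 <= expect g.
Proof. by move=> g0; rewrite -(expect_cst 0); apply: le_expect. Qed.

Lemma expect_eq0 g : (forall x, 0 <= g x) -> expect g = 0 -> forall x, g x = 0.
Proof.
move=> g0 /eqP; rewrite mulf_eq0 invr_eq0 (gt_eqF card_cube_gt0) orbF.
by rewrite psumr_eq0 // => /allP E x; apply/eqP/E; rewrite mem_index_enum.
Qed.

End Expectation.

(** * Conditional expectations obtained by averaging over coordinates *)

Section Averaging.
Variables (R : realType) (n : nat).
Implicit Types (g h : cube n -> R) (i j : 'I_n) (s : seq 'I_n) (x : cube n).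

Definition flip i x := cube_add x (cube_e i).

Definition avg i g x : R := (g x + g (flip i x)) / 2.

Definition avgs s g := foldr avg g s.

Definition diff i g x : R := g x - g (flip i x).

Lemma flipK i : involutive (flip i).
Proof. by move=> x; apply/ffunP => j; rewrite !ffunE addbK. Qed.

Lemma flipC i j x : flip i (flip j x) = flip j (flip i x).
Proof. by apply/ffunP => k; rewrite !ffunE -!addbA [(k == j) (+) _]addbC. Qed.

Lemma expect_flip i g : expect (fun x => g (flip i x)) = expect g.
Proof.
by rewrite /expect [in RHS](reindex_inj (can_inj (flipK i))).
Qed.

Lemma expect_avg i g : expect (avg i g) = expect g.
Proof.
rewrite (_ : avg i g = fun x => 2^-1 * (g x + g (flip i x))).
  by rewrite expectZ expectD expect_flip; lra.
by apply/funext => x; rewrite mulrC.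
Qed.

Lemma avgC i j g : avg i (avg j g) = avg j (avg i g).
Proof. by apply/funext => x; rewrite /avg flipC; lra. Qed.

Lemma avgs_avg s i g : avgs s (avg i g) = avg i (avgs s g).
Proof. by elim: s => //= j s ->; rewrite avgC. Qed.

Lemma avgsB s g h : avgs s (fun x => g x - h x) = fun x => avgs s g x - avgs s h x.
Proof. by elim: s => //= i s ->; apply/funext => x; rewrite /avg; lra. Qed.

Lemma diff_avg i j g : diff i (avg j g) = avg j (diff i g).
Proof. by apply/funext => x; rewrite /avg /diff flipC; lra. Qed.

Lemma expect_avgs s g : expect (avgs s g) = expect g.
Proof. by elim: s => //= i s <-; rewrite expect_avg. Qed.

Lemma avgs_ge0 s g : (forall x, 0 <= g x) -> forall x, 0 <= avgs s g x.
Proof. by move=> g0; elim: s => //= i s IH x; rewrite divr_ge0 // addr_ge0. Qed.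

Lemma expect_norm_avgs s g :
  expect (fun x => `|avgs s g x|) <= expect (fun x => `|g x|).
Proof.
elim: s => //= i s; apply: le_trans.
rewrite -[leRHS](expect_avg i); apply: le_expect => x.
rewrite /avg normrM [X in _ * X <= _]ger0_norm ?invr_ge0 ?ler0n //.
by apply: ler_wpM2r; rewrite ?invr_ge0 ?ler0n ?ler_normD.
Qed.

(** Pythagoras: on each edge in direction [i], the variance of the two values is their mean square
    minus their squared mean. *)
Lemma expect_sq_avg i g :
  expect (fun x => (g x - avg i g x) ^+ 2)
    = expect (fun x => g x ^+ 2) - expect (fun x => avg i g x ^+ 2).
Proof.
rewrite -(expect_avg i (fun x => g x ^+ 2)) -expectB; congr expect.
by apply/funext => x; rewrite /avg; lra.
Qed.

Lemma avgs_flip s i g x : i \in s -> avgs s g (flip i x) = avgs s g x.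
Proof.
elim: s x => //= j s IH x; rewrite inE => /predU1P[->|/IH E].
  by rewrite /avg flipK addrC.
by rewrite /avg flipC !E.
Qed.

Lemma flip_invariant_cst g :
  (forall i x, g (flip i x) = g x) -> forall x y, g x = g y.
Proof.
move=> gi x y.
(* A path from [x] to [y]: each step either stays put or flips one coordinate. *)
pose z k : cube n := [ffun j : 'I_n => if (j < k)%N then y j else x j].
have zg k : (k <= n)%N -> g (z k) = g x.
  elim: k => [_|k IH kn]; first by congr g; apply/ffunP => j; rewrite ffunE.
  rewrite -IH ?(ltnW kn) //; pose i := Ordinal kn.
  have [xy|xy] := eqVneq (x i) (y i).
    congr g; apply/ffunP => j; rewrite !ffunE ltnS leq_eqVlt.
    have [jk|//] := eqVneq (j : nat) k.
    by have -> : j = i by [apply: val_inj]; rewrite /= ltnn xy.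
  rewrite -(gi i (z k)); congr g; apply/ffunP => j; rewrite !ffunE ltnS leq_eqVlt.
  have [->|ji] := eqVneq j i; first
    by rewrite /= eqxx ltnn; case: (x i) (y i) xy => [] [].
  have -> : (j == k :> nat) = false by apply: contraNF ji => /eqP jk; apply/eqP/val_inj.
  by rewrite addbF.
by rewrite -(zg n) //; congr g; apply/ffunP => j; rewrite ffunE ltn_ord.
Qed.

Lemma avgs_enum g x : avgs (enum 'I_n) g x = expect g.
Proof.
rewrite -(expect_avgs (enum 'I_n)) -[LHS](@expect_cst R n); congr expect.
apply/funext => y; apply: flip_invariant_cst => i z.
by rewrite avgs_flip // mem_enum.
Qed.

End Averaging.

(** * The logarithmic Sobolev inequality on the cube, and a lower bound for entropy *)

Section LogSobolev.
Variables (R : realType) (n : nat).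
Implicit Types (g h : cube n -> R) (i j : 'I_n) (s : seq 'I_n) (x : cube n).

(** The conditional L2 norm of [g]. It interpolates between [|g|] and the constant
    [Num.sqrt (E g^2)], so that entropy can be split coordinate by coordinate. *)
Let rms s g x : R := Num.sqrt (avgs s (fun y => g y ^+ 2) x).

Let rms_sq s g x : rms s g x ^+ 2 = avgs s (fun y => g y ^+ 2) x.
Proof. by rewrite sqr_sqrtr // avgs_ge0 // => y; rewrite sqr_ge0. Qed.

(** Taking norms does not increase differences: for empty [s] this compares [|g|] with [g], and each
    further coordinate uses the reverse triangle inequality on a square of the cube. *)
Let expect_sq_diff_rms s g i :
  expect (fun x => diff i (rms s g) x ^+ 2) <= expect (fun x => diff i g x ^+ 2).
Proof.
elim: s => [|j s].
  apply: le_expect => x; rewrite /diff /rms /= !sqrtr_sqr.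
  rewrite -[leLHS]ger0_norm ?sqr_ge0 // -[leRHS]ger0_norm ?sqr_ge0 // !normrX.
  by rewrite lerXn2r ?nnegrE // ler_dist_dist.
apply: le_trans; rewrite -[leRHS](expect_avg j); apply: le_expect => x.
have E y : rms (j :: s) g y =
    Num.sqrt ((rms s g y ^+ 2 + rms s g (flip j y) ^+ 2) / 2).
  by rewrite !rms_sq.
rewrite /avg /diff !E flipC; apply: le_trans (sqrt_mean_sq_dist _ _ _ _) _;
  by rewrite ?sqrtr_ge0.
Qed.

(** Tensorisation: adding [i] to [s] costs one two-point inequality for [rms s g] on the edges in
    direction [i], and the previous bound returns from [rms s g] to [g]. *)
Let ent_avgs s g :
  expect (fun x => g x ^+ 2 * ln (g x ^+ 2))
    - expect (fun x => rms s g x ^+ 2 * ln (rms s g x ^+ 2))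
  <= (\sum_(i <- s) expect (fun x => diff i g x ^+ 2)) / 2.
Proof.
elim: s => [|i s IH].
  rewrite big_nil mul0r subr_le0; apply: le_expect => x.
  by rewrite rms_sq.
rewrite big_cons.
suff : expect (fun x => rms s g x ^+ 2 * ln (rms s g x ^+ 2)) -
  expect (fun x => rms (i :: s) g x ^+ 2 * ln (rms (i :: s) g x ^+ 2)) <=
  expect (fun x => diff i g x ^+ 2) / 2 by lra.
apply: le_trans (_ : expect (fun x => diff i (rms s g) x ^+ 2) / 2 <= _); last first.
  by apply: ler_wpM2r; [lra | exact: expect_sq_diff_rms].
rewrite -(expect_avg i) -expectB [leRHS]mulrC -expectZ; apply: le_expect => x.
rewrite (rms_sq (i :: s)) /= /avg -!rms_sq [leRHS]mulrC.
by apply: two_point_log_sobolev; rewrite sqrtr_ge0.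
Qed.

Lemma log_sobolev g :
  expect (fun x => g x ^+ 2 * ln (g x ^+ 2))
    - expect (fun x => g x ^+ 2) * ln (expect (fun x => g x ^+ 2))
  <= (\sum_i expect (fun x => diff i g x ^+ 2)) / 2.
Proof.
have := ent_avgs (enum 'I_n) g; rewrite big_enum /=; apply: le_trans.
rewrite lerD2l lerN2 -[leRHS](@expect_cst R n); apply: le_expect => x.
by rewrite rms_sq avgs_enum.
Qed.

(* The supremum over [l] of the left-hand side is
   [E g^2 * ln (E g^2 / (E |g|)^2)]. *)
Lemma entropy_sq_lower_bound g (l : R) : 0 < l ->
  expect (fun x => g x ^+ 2) * (ln l + 1) - l * expect (fun x => `|g x|) ^+ 2
  <= expect (fun x => g x ^+ 2 * ln (g x ^+ 2))
    - expect (fun x => g x ^+ 2) * ln (expect (fun x => g x ^+ 2)).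
Proof.
move=> l0; set M := expect (fun x => g x ^+ 2); set m := expect (fun x => `|g x|).
have m_ge0 : 0 <= m by apply: expect_ge0.
have : 0 <= M by apply: expect_ge0 => x; rewrite sqr_ge0.
rewrite le_eqVlt => /predU1P[M0|M0].
  have g0 := expect_eq0 (fun x => sqr_ge0 (g x)) (esym M0).
  rewrite (_ : (fun x => _) = fun=> 0); last first.
    by apply/funext => x; rewrite g0 mul0r.
  by rewrite expect_cst -M0 !mul0r !sub0r oppr0 oppr_le0 mulr_ge0 ?sqr_ge0 // ltW.
have m0 : 0 < m.
  rewrite lt_neqAle m_ge0 andbT eq_sym; apply/eqP => m0; move: M0.
  rewrite /M (_ : (fun x => _) = fun=> 0) ?expect_cst ?ltxx //.
  apply/funext => x; apply/eqP; rewrite sqrf_eq0 -normr_eq0; apply/eqP.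
  exact: (expect_eq0 _ m0).
(* The pointwise bound below is [ln (c / a) <= c / a - 1] with [a = |g x|]; this [c] maximises its
   expectation [(2 * ln c + 2) * M - 2 * c * m]. *)
pose c := M / m; have c0 : 0 < c by rewrite divr_gt0.
have pointwise x : (2 * ln c + 2) * g x ^+ 2 - 2 * c * `|g x|
    <= g x ^+ 2 * ln (g x ^+ 2).
  rewrite -!(real_normK (num_real (g x))).
  have : 0 <= `|g x| by [].
  rewrite le_eqVlt => /predU1P[<-|a0].
    by rewrite expr0n /= !(mulr0, mul0r) subr0.
  set a := `|g x| in a0 *.
  have := @ln_le_subr1 _ (c / a) (divr_gt0 c0 a0).
  rewrite ln_div ?posrE // ln_sqr // => H.
  have : a ^+ 2 * (ln c - ln a) <= a ^+ 2 * (c / a - 1).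
    by rewrite ler_pM2l ?exprn_gt0.
  have -> : a ^+ 2 * (c / a - 1) = c * a - a ^+ 2 by field; rewrite gt_eqF.
  lra.
have : (2 * ln c + 2) * M - 2 * c * m <= expect (fun x => g x ^+ 2 * ln (g x ^+ 2)).
  by rewrite -!expectZ -expectB; apply: le_expect.
have -> : 2 * c * m = 2 * M by rewrite /c; field; rewrite gt_eqF.
by have := ln_ratio_ge M0 m0 l0; rewrite -/c; lra.
Qed.

End LogSobolev.

(** * Energy, influences and the sum over martingale differences *)

Section Influences.
Variables (R : realType) (n : nat).
Implicit Types (g : cube n -> R) (i j : 'I_n) (s : seq 'I_n) (x : cube n).

Definition energy g : R := \sum_i expect (fun x => diff i g x ^+ 2).

Lemma energy_cst (a : R) : energy (fun=> a) = 0.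
Proof.
by rewrite /energy big1 // => i _; rewrite /diff subrr expr0n /= expect_cst.
Qed.

(** Since [diff j] commutes with [avg i], this is Pythagoras for each [diff j g]; it makes the
    energies of the martingale differences telescope. *)
Lemma energy_avg i g : energy (fun x => g x - avg i g x) = energy g - energy (avg i g).
Proof.
rewrite /energy -sumrB; apply: eq_bigr => j _.
rewrite diff_avg -expect_sq_avg -diff_avg; congr expect; apply/funext => x.
by rewrite /diff; congr (_ ^+ 2); ring.
Qed.

(* The martingale differences are [avgs s g - avg i (avgs s g)]; the parameter
   [l] linearises the logarithm so that their inequalities can be added up. *)
Lemma martingale_entropy_bound g (l : R) s : 0 < l ->
  (expect (fun x => g x ^+ 2) - expect (fun x => avgs s g x ^+ 2)) * (ln l + 1)
    - l * \sum_(i <- s) expect (fun x => `|g x - avg i g x|) ^+ 2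
  <= (energy g - energy (avgs s g)) / 2.
Proof.
move=> l0; elim: s => [|i s IH]; first by rewrite big_nil !subrr !mul0r mulr0 subrr.
rewrite big_cons /=; set h := avgs s g in IH *.
have := le_trans (entropy_sq_lower_bound (fun x => h x - avg i h x) l0) (log_sobolev _).
rewrite -/(energy _) energy_avg expect_sq_avg => H.
(* The martingale difference of [h] is the average over [s] of [g - avg i g], and averaging
   contracts the L1 norm. *)
have : l * expect (fun x => `|h x - avg i h x|) ^+ 2 <=
    l * expect (fun x => `|g x - avg i g x|) ^+ 2.
  rewrite ler_pM2l // lerXn2r ?nnegrE ?expect_ge0 //.
  rewrite /h -avgs_avg.
  rewrite -[X in expect X](_ : (fun x => `|avgs s (fun y => g y - avg i g y) x|)
    = _).
    exact: expect_norm_avgs.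
  by apply/funext => x; rewrite avgsB.
lra.
Qed.

Lemma influenceE (f : cube n -> bool) i :
  influence R f i = expect (fun x => (f x != f (flip i x))%:R).
Proof.
rewrite /influence /Pr /expect; congr (_ / _).
by rewrite -sum1_card natr_sum [LHS]big_mkcond; apply: eq_bigr => x _;
  rewrite inE; case: ifP.
Qed.

Lemma energy_indicator (f : cube n -> bool) :
  energy (fun x => (f x)%:R) = \sum_i influence R f i.
Proof.
apply: eq_bigr => i _; rewrite influenceE; congr expect; apply/funext => x.
rewrite /diff; case: (f x); case: (f _);
  by rewrite /= ?subrr ?subr0 ?sub0r ?sqrrN ?expr1n ?expr0n.
Qed.

Lemma expect_norm_sub_avg_indicator (f : cube n -> bool) i :
  expect (fun x => `|(f x)%:R - avg i (fun y => (f y)%:R) x|) = influence R f i / 2.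
Proof.
rewrite influenceE mulrC -expectZ; congr expect; apply/funext => x.
rewrite (_ : _ - _ = 2^-1 * ((f x)%:R - (f (flip i x))%:R)); last by rewrite /avg; field.
rewrite normrM ger0_norm ?invr_ge0 ?ler0n //; congr (_ * _).
by case: (f x); case: (f _); rewrite /= ?subrr ?subr0 ?sub0r ?normrN ?normr1 ?normr0.
Qed.

End Influences.

Theorem theorem1p2 (R : realType) (n : nat) (f : cube n -> bool) :
  let mu : R := mean R f in
  4 * mu * (1 - mu) *
    expR (- ((1 / 2) / (mu * (1 - mu)) * \sum_(i < n) influence R f i))
  <= \sum_(i < n) influence R f i ^+ 2.
Proof.
cbv zeta; set mu := mean R f; pose g x : R := (f x)%:R.
have g_sq x : g x ^+ 2 = g x by rewrite /g; case: (f x); rewrite ?expr1n ?expr0n.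
have Eg2 : expect (fun x => g x ^+ 2) = mu by congr expect; apply/funext.
have mu_ge0 : 0 <= mu by apply: expect_ge0 => x; rewrite ler0n.
have mu_le1 : mu <= 1.
  by rewrite -(expect_cst n 1); apply: le_expect => x; case: (f x).
set v := mu * (1 - mu); set I := \sum_(i < n) influence R f i.
rewrite -(mulrA 4) -/v.
have : 0 <= v by rewrite mulr_ge0 // subr_ge0.
(* For constant [f] the factor [v] makes the left-hand side 0, whatever the exponential is. *)
rewrite le_eqVlt => /predU1P[<-|v0].
  by rewrite mulr0 mul0r sumr_ge0 // => i _; rewrite sqr_ge0.
(* This [l] gives [v * (ln l + 1) = I / 2 + v], so the energy term [I / 2] cancels and [v] is at
   most [l / 4] times the sum of the squared influences. *)
have := @martingale_entropy_bound R n g (expR (1 / 2 / v * I)) (enum 'I_n) (expR_gt0 _).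
rewrite !big_enum /= expRK Eg2.
rewrite (_ : avgs _ _ = fun=> mu); last by apply/funext => x; rewrite avgs_enum.
rewrite expect_cst energy_cst subr0.
rewrite energy_indicator -/I.
under eq_bigr do rewrite expect_norm_sub_avg_indicator exprMn mulrC.
rewrite -mulr_sumr.
have -> : mu - mu ^+ 2 = v by rewrite /v; ring.
have -> : v * (1 / 2 / v * I + 1) = I / 2 + v by field; rewrite gt_eqF.
rewrite expRN => H.
rewrite ler_pdivrMr ?expR_gt0 //; lra.
Qed.
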